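(* Let $(S,P)$ be a $\Gamma$-contraction acting on a Hilbert space $\mathcal H$. Then $S=T_1+T_2$ and $P=T_1T_2$ for a pair of commuting contractions $T_1,T_2$ on $\mathcal H$ if and only if $S^2-4P$ has a square root $\Delta$ (that is, there is a bounded operator $\Delta$ on $\mathcal H$ with $\Delta^2=S^2-4P$) such that (i) $\Delta$ commutes with $S$ and $P$; (ii) $\|S+\Delta\|\leq 2$ and $\|S-\Delta\|\leq 2$.
   Context: All operators are bounded linear operators on complex Hilbert spaces; a contraction is an operator of norm at most $1$. The closed symmetrized bidisc is $\Gamma=\{(z_1+z_2,\,z_1z_2) : z_1,z_2\in\mathbb C,\ |z_1|\leq 1,\ |z_2|\leq 1\}\subset\mathbb C^2$. A pair of commuting operators $(S,P)$ on a Hilbert space is called a $\Gamma$-contraction if $\Gamma$ is a spectral set for $(S,P)$, that is, the Taylor joint spectrum $\sigma_T(S,P)$ is contained in $\Gamma$ and $\|f(S,P)\|\leq \sup_{(z_1,z_2)\in\Gamma}|f(z_1,z_2)|$ for all rational functions $f=p/q$ with $p,q\in\mathbb C[z_1,z_2]$ and $q$ having no zero in $\Gamma$. *)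

(* Defs.v *)
From HB Require Import structures.
From mathcomp Require Import all_boot all_order all_algebra.
From mathcomp Require Import all_classical all_reals all_analysis.
From mathcomp Require Import complex.

Set Implicit Arguments.
Unset Strict Implicit.
Unset Printing Implicit Defensive.

Import Order.TTheory GRing.Theory Num.Theory.
Import numFieldNormedType.Exports.

Local Open Scope classical_set_scope.
Local Open Scope ring_scope.

(* The inner product is linear in its first argument and conjugate-linear in
   the second one. *)
HB.mixin Record isHilbert (R : realType) H of CompleteNormedModule R[i] H := {
  inner : {dot H for (@Num.conj R[i])} ;
  inner_norm : forall x : H, inner x x = `|x| ^+ 2 }.

#[short(type="hilbertType")]
HB.structure Definition Hilbert (R : realType) :=
  {H of CompleteNormedModule R[i] H & isHilbert R H}.

Section bounded_operators.
Context {R : realType} (H : hilbertType R).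

Definition bounded_op : {pred H -> H} :=
  mem [set T : H -> H | linear T /\ continuous T].

Record bop := Bop { bop_fun :> H -> H ; bop_subproof : bop_fun \in bounded_op }.

HB.instance Definition _ := [isSub for bop_fun].
HB.instance Definition _ := [Choice of bop by <:].

Lemma bopP (S T : bop) : S = T <-> S =1 T.
Proof. by split=> [->//|ST]; exact/val_inj/funext. Qed.

Lemma bounded_opP (T : H -> H) :
  reflect (linear T /\ continuous T) (T \in bounded_op).
Proof. by apply: (iffP idP); rewrite inE. Qed.

Lemma bop_linear (T : bop) : linear T.
Proof. by case: T => T /= /bounded_opP[]. Qed.

Lemma bop_continuous (T : bop) : continuous T.
Proof. by case: T => T /= /bounded_opP[]. Qed.

HB.instance Definition _ (T : bop) :=
  GRing.isLinear.Build R[i] H H *:%R T (bop_linear T).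

Lemma bounded_op_submod_closed : submod_closed bounded_op.
Proof.
split=> [|a S T /bounded_opP[lS cS] /bounded_opP[lT cT]]; apply/bounded_opP.
  split=> [b x y|]; first by rewrite /= scaler0 addr0.
  exact: cst_continuous.
split=> [b x y|x].
  change (a *: S (b *: x + y) + T (b *: x + y) =
          b *: (a *: S x + T x) + (a *: S y + T y)).
  by rewrite lS lT !scalerDr !scalerA (mulrC a) addrACA.
by apply: continuousD; [apply: continuousZl_tmp; exact: cS|exact: cT].
Qed.

HB.instance Definition _ :=
  GRing.isSubmodClosed.Build _ _ bounded_op bounded_op_submod_closed.
HB.instance Definition _ := [SubChoice_isSubLmodule of bop by <:].

Lemma bounded_op_id : (id : H -> H) \in bounded_op.
Proof. by apply/bounded_opP; split=> // x; exact: cvg_id. Qed.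

Lemma bounded_op_comp (S T : bop) : (S \o T : H -> H) \in bounded_op.
Proof.
apply/bounded_opP; split=> [a x y|x] /=; first by rewrite !linearP.
by apply: continuous_comp; exact: bop_continuous.
Qed.

Definition bop_one := Bop bounded_op_id.
Definition bop_mul (S T : bop) := Bop (bounded_op_comp S T).

Let bop_mulA : associative bop_mul.
Proof. by move=> S T U; apply/bopP. Qed.
Let bop_mul1r : left_id bop_one bop_mul.
Proof. by move=> T; apply/bopP. Qed.
Let bop_mulr1 : right_id bop_one bop_mul.
Proof. by move=> T; apply/bopP. Qed.
Let bop_mulDl : left_distributive bop_mul +%R.
Proof. by move=> S T U; apply/bopP. Qed.
Let bop_mulDr : right_distributive bop_mul +%R.
Proof.
by move=> S T U; apply/bopP => x; exact: (linearD S (T x) (U x)).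
Qed.

(* Operators form a ring under composition; it may be trivial since H may be
   the zero space. *)
HB.instance Definition _ := GRing.Zmodule_isPzRing.Build bop
  bop_mulA bop_mul1r bop_mulr1 bop_mulDl bop_mulDr.

Lemma bop_scaleAl (a : R[i]) (S T : bop) : a *: (S * T) = (a *: S) * T.
Proof. exact/bopP. Qed.

Lemma bop_scaleAr (a : R[i]) (S T : bop) : a *: (S * T) = S * (a *: T).
Proof. by apply/bopP => x; exact/esym/(linearZZ S a (T x)). Qed.

End bounded_operators.

Section Gamma_contraction.
Context {R : realType}.
Local Notation C := R[i].

(* Norms take values in C; complex.Re maps them to R. *)
Definition opnorm_set {H : hilbertType R} (T : bop H) : set R :=
  [set complex.Re `|T x| | x in [set x | `|x| <= 1]].

Definition opnorm {H : hilbertType R} (T : bop H) : R := sup (opnorm_set T).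

Lemma opnorm_has_sup {H : hilbertType R} (T : bop H) : has_sup (opnorm_set T).
Proof.
split; first by exists (complex.Re `|T 0|), 0 => //=; rewrite normr0.
have /bounded_funP/(_ 1)[M TM] :=
  (linear_bounded_continuous T).2 (@bop_continuous _ H T).
exists (complex.Re M) => _ [x /TM + <-].
by rewrite lecE => /andP[].
Qed.

Definition op_contraction {H : hilbertType R} (T : bop H) := opnorm T <= 1.

Definition Gamma : set (C * C) :=
  [set (z.1 + z.2, z.1 * z.2) | z in [set z : C * C | `|z.1| <= 1 /\ `|z.2| <= 1]].

(* Exactness of the Koszul complex 0 -> H -> H (+) H -> H -> 0 with maps
   x |-> (A x, B x) and (x, y) |-> A y - B x. *)
Definition koszul_exact {H : hilbertType R} (A B : bop H) : Prop :=
  [/\ forall x : H, A x = 0 -> B x = 0 -> x = 0,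
      forall x y : H, A y - B x = 0 -> exists z : H, x = A z /\ y = B z
    & forall z : H, exists x y : H, A y - B x = z].

Definition taylor_spectrum {H : hilbertType R} (S P : bop H) : set (C * C) :=
  [set z : C * C | ~ koszul_exact (S - z.1 *: (1 : bop H)) (P - z.2 *: (1 : bop H))].

(* The inner variable of p : {poly {poly C}} is z_1 and the outer one is z_2,
   that is, p = \sum_(i, j) p`_j`_i z_1^i z_2^j. *)
Definition poly_eval (p : {poly {poly C}}) (z : C * C) : C := p.[z.2%:P].[z.1].

Definition poly_op {H : hilbertType R} (p : {poly {poly C}}) (S P : bop H) :
    bop H :=
  \sum_(j < size p) \sum_(i < size p`_j) p`_j`_i *: (S ^+ i * P ^+ j).

Definition op_inverse {H : hilbertType R} (T Q : bop H) : Prop :=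
  T * Q = 1 /\ Q * T = 1.

(* f(S, P) = p(S, P) q(S, P)^-1.  When the Taylor spectrum lies in Gamma, q(S, P)
   is invertible by the spectral mapping theorem, and Q is its unique inverse.
   The supremum is taken in the extended reals. *)
Definition Gamma_spectral {H : hilbertType R} (S P : bop H) : Prop :=
  taylor_spectrum S P `<=` Gamma /\
  forall p q : {poly {poly C}},
    (forall z, Gamma z -> poly_eval q z != 0) ->
    exists Q : bop H, op_inverse (poly_op q S P) Q /\
      ((opnorm (poly_op p S P * Q))%:E <=
       ereal_sup [set (complex.Re `|poly_eval p z / poly_eval q z|)%:E
                 | z in Gamma])%E.

Definition Gamma_contraction {H : hilbertType R} (S P : bop H) : Prop :=
  GRing.comm S P /\ Gamma_spectral S P.

End Gamma_contraction.

(* Main.v *)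
Require Import Defs.
From mathcomp Require Import all_boot all_order all_algebra.
From mathcomp Require Import all_classical all_reals all_analysis.
From mathcomp Require Import complex.

Local Open Scope ring_scope.

Import Order.TTheory GRing.Theory Num.Theory.

(** The correspondence is D = T1 - T2, with inverse T1 = (S + D) / 2 and
    T2 = (S - D) / 2: the identity (T1 - T2)^2 = (T1 + T2)^2 - 4 T1 T2 matches
    the equations, and homogeneity of the norm matches the bounds. *)

(** Once [xy] turns [x * y] into [y * x], both sides expand to [a - 2 b + c] in the abbreviations of
    the proof. *)
Lemma sqrrB_subM4_comm (A : pzRingType) (x y : A) (xy : GRing.comm x y) :
  (x - y) ^+ 2 = (x + y) ^+ 2 - (x * y) *+ 4.
Proof.
rewrite !expr2 mulrBr !mulrDr !mulrBl !mulrDl xy.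
set a := x * x; set b := y * x; set c := y * y.
(* Of the four subtracted copies of [b], two are taken from [a + b] and two from [c + b]. *)
rewrite [in RHS](mulrnDr b 2 2) [in RHS]mulr2n opprD.
by rewrite [in RHS]opprD [RHS]addrACA (addrC b c) !addrKA opprK (addrC c).
Qed.

(** Every value in the supremum on the left is [c] times a value in the one on the right. Used with
    [c] equal to 2 and to 1/2, this turns bounds by 2 into bounds by 1 and back. *)
Lemma opnormZ_le (R : realType) (H : hilbertType R) (c : R) (T : bop H)
    (c_ge0 : 0 <= c) :
  opnorm ((c%:C)%C *: T) <= c * opnorm T.
Proof.
apply: ge_sup => [|_ [x x_le1 <-]].
  by case: (opnorm_has_sup ((c%:C)%C *: T)).
have -> : ((c%:C)%C *: T) x = (c%:C)%C *: T x by [].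
rewrite normrZ ger0_norm ?ler0c //.
(* The real part is multiplicative here because [c%:C] has imaginary part zero. *)
have -> : complex.Re ((c%:C)%C * `|T x|) = c * complex.Re `|T x|.
  by case: (`|T x|) => a b /=; rewrite mul0r subr0.
rewrite ler_wpM2l //; apply: ub_le_sup; last by exists x.
by case: (opnorm_has_sup T).
Qed.

Lemma opnorm_double_le2 (R : realType) (H : hilbertType R) (T : bop H) :
  (opnorm (T *+ 2) <= 2) = op_contraction T.
Proof.
have two : (2%:C)%C = 2%:R :> R[i] by rewrite rmorph_nat.
have T2E : T *+ 2 = (2%:C)%C *: T by rewrite two scaler_nat.
have TE : T = (2^-1%:C)%C *: (T *+ 2).
  by rewrite T2E scalerA -rmorphM /= mulVf ?pnatr_eq0 // scale1r.
apply/idP/idP => [T2_le2|T_le1].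
  rewrite /op_contraction TE (le_trans (@opnormZ_le _ _ _ _ _)) ?invr_ge0 //.
  by rewrite ler_pdivrMl ?mulr1.
rewrite T2E (le_trans (@opnormZ_le _ _ _ _ _)) //.
by rewrite -[leRHS]mulr1 ler_wpM2l.
Qed.

Theorem theorem3p1 (R : realType) (H : hilbertType R) (S P : bop H)
    (hSP : Gamma_contraction S P) :
  (exists T1 T2 : bop H,
      [/\ GRing.comm T1 T2, op_contraction T1, op_contraction T2,
          S = T1 + T2 & P = T1 * T2])
  <->
  (exists D : bop H,
      [/\ D ^+ 2 = S ^+ 2 - (4%:R : R[i]) *: P,
          GRing.comm D S, GRing.comm D P,
          opnorm (S + D) <= 2 & opnorm (S - D) <= 2]).
Proof.
split=> [[T1 [T2 [T12 T1_le1 T2_le1 -> ->]]]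
  |[D [D2 DS DP SD_le2 SBD_le2]]].
  have T1D : GRing.comm T1 (T1 - T2) by apply: commrB.
  have T2D : GRing.comm T2 (T1 - T2) by apply: commrB => //; exact: commr_sym.
  exists (T1 - T2); split.
  - by rewrite scaler_nat sqrrB_subM4_comm.
  - by apply: commrD; exact: commr_sym.
  - by apply: commrM; exact: commr_sym.
  (* With [D = T1 - T2], [S + D] is twice [T1] and [S - D] is twice [T2]. *)
  - by rewrite addrACA subrr addr0 -mulr2n opnorm_double_le2.
  - by rewrite opprB addrC addrA subrK -mulr2n opnorm_double_le2.
have half (U : bop H) : (2^-1 : R[i]) *: U *+ 2 = U.
  by rewrite -scaler_nat scalerA mulfV ?pnatr_eq0 // scale1r.
exists (2^-1 *: (S + D)), (2^-1 *: (S - D)).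
have SDcomm : GRing.comm (S + D) (S - D).
  by apply/commr_sym/commrD; apply/commr_sym/commrB => //; exact: commr_sym.
split.
- by rewrite /GRing.comm -!bop_scaleAl -!bop_scaleAr SDcomm.
- by rewrite -opnorm_double_le2 half.
- by rewrite -opnorm_double_le2 half.
- by rewrite -scalerDr addrACA subrr addr0 -mulr2n -scalerMnr half.
- rewrite -bop_scaleAl -bop_scaleAr scalerA.
  (* The cross terms cancel since [D] commutes with [S], leaving [S ^+ 2 - D ^+ 2]; the two factors
     1/2 then absorb the 4. *)
  have -> : (S + D) * (S - D) = 4%:R *: P.
    transitivity (S ^+ 2 - D ^+ 2); last by rewrite D2 opprB addrC subrK.
    by rewrite mulrDl !mulrBr DS addrA subrK !expr2.
  by rewrite scalerA -invfM -natrM mulVf ?pnatr_eq0 // scale1r.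
Qed.
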